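(* Let $r\ge 1$, $n\ge 2r$ be integers and $m=\lfloor n/r\rfloor$. Consider a graph $\mathcal{G}=(\mathcal{V},\mathcal{E}_1,\mathcal{E}_2)$ with $m$ vertices for which the subgraph $\mathcal{G}_1=(\mathcal{V},\mathcal{E}_1)$ is connected and non-bipartite. Assume that there exists a maximal independent set $\mathcal{S}=\mathcal{S}(\mathcal{G}_1)$ of $\mathcal{G}_1$ whose vertices each have a self-loop (in $\mathcal{G}_1$), and that the induced subgraph $\mathcal{G}_2[\mathcal{S}]$ of $\mathcal{G}_2=(\mathcal{V},\mathcal{E}_2)$ is connected. Then there exists an instance $\mathcal{P}_{\mathbf{M}^*,\Omega,n,r}$ in $\mathcal{L}(\mathcal{G},n,r)$ for which the problem $\min_{\mathbf{X}\in\mathbb{R}^{n\times r}}\|(\mathbf{X}\mathbf{X}^T-\mathbf{M}^* )_\Omega\|_F^2$ has at least $2^{r(|\mathcal{S}(\mathcal{G}_1)|-1)}-1$ equivalence classes of spurious solutions.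
   Context: $[m]=\{1,\dots,m\}$; $\mathbb{S}^n_+$ is the set of $n\times n$ real PSD matrices. For $\Omega\subset[n]\times[n]$, $\mathbf{M}_\Omega$ denotes the matrix whose $(i,j)$ entry is $\mathbf{M}_{ij}$ if $(i,j)\in\Omega$ and $0$ otherwise. The matrix completion problem $\mathcal{P}_{\mathbf{M}^*,\Omega,n,r}$ is: find $\mathbf{M}\in\mathbb{R}^{n\times n}$ with $\mathrm{rank}(\mathbf{M})\le r$, $\mathbf{M}\succeq 0$, $\mathbf{M}_\Omega=\mathbf{M}^*_\Omega$. With $m=\lfloor n/r\rfloor$, the first $mr$ rows and columns of an $n\times n$ matrix $\mathbf{M}^*$ are divided into $m\times m$ blocks of size $r\times r$; the block at position $(i,j)$ is $\mathbf{M}^*_{i,j}$. Let $\mathcal{G}=(\mathcal{G}_1,\mathcal{G}_2)=(\mathcal{V},\mathcal{E}_1,\mathcal{E}_2)$ be a pair of undirected graphs (self-loops allowed) on $\mathcal{V}=[m]$ with disjoint edge sets $\mathcal{E}_1,\mathcal{E}_2\subset[m]\times[m]$. The induced measurement set $\Omega(\mathcal{G})$ is: if $(i,j)\in\mathcal{E}_1$, all entries of block $(i,j)$ are observed; if $(i,j)\in\mathcal{E}_2$, all nondiagonal entries of the block $(i,j)$ are observed; otherwise no entry of the block is observed; in addition, the last $n-mr$ rows and columns are fully observed. The class $\mathcal{L}(\mathcal{G},n,r)$ consists of the problems $\mathcal{P}_{\mathbf{M}^*,\Omega,n,r}$ such that: (i) $\mathbf{M}^*\in\mathbb{S}^n_+$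 has rank $r$; (ii) $\mathbf{M}^*_{i,j}$ has rank $r$ for all $i,j\in[m]$; (iii) $\Omega=\Omega(\mathcal{G})$ with $\mathcal{G}_1$ connected and non-bipartite (a self-loop counts as an odd cycle). An independent set is a set of nodes no two (distinct) of which are adjacent; it is maximal if it is not a strict subset of another independent set. A solution is spurious if it is a local minimum with objective value larger than the optimal objective value. Two points $\mathbf{X},\mathbf{X}'\in\mathbb{R}^{n\times r}$ are equivalent if $\mathbf{X}'=\mathbf{X}\mathbf{Q}$ for some orthogonal $\mathbf{Q}\in\mathbb{R}^{r\times r}$. *)

(* Defs.v *)
From mathcomp Require Import all_boot all_order all_algebra.
From mathcomp Require Import all_classical all_reals all_analysis.

Set Implicit Arguments.
Unset Strict Implicit.
Unset Printing Implicit Defensive.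

Import Order.TTheory GRing.Theory Num.Theory.
Import numFieldNormedType.Exports.

Local Open Scope classical_set_scope.
Local Open Scope ring_scope.

(* A graph on T, self-loops allowed, is a symmetric relation on T. *)

Section Graphs.
Variable T : finType.
Implicit Types (e : rel T) (S : {set T}).

Definition graph_pair e1 e2 : Prop :=
  [/\ symmetric e1, symmetric e2 & forall x y, ~~ (e1 x y && e2 x y)].

Definition connected_graph e : Prop := forall x y, connect e x y.

Definition induced_rel e S : rel T := [rel x y | [&& x \in S, y \in S & e x y]].

(* Connectedness of e[S]: its vertex set is S, not the whole of T. *)
Definition connected_induced e S : Prop :=
  {in S &, forall x y, connect (induced_rel e S) x y}.

(* A self-loop is an edge inside one part, so it precludes bipartiteness. *)
Definition bipartite e : Prop :=
  exists A : {set T}, forall x y, e x y -> (x \in A) != (y \in A).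

(* Self-loops do not prevent independence. *)
Definition independent e S : bool :=
  [forall x in S, forall y in S, (x != y) ==> ~~ e x y].

Definition maximal_independent e S : bool := maxset (independent e) S.

End Graphs.

Section Blocks.
Variables n r : nat.
Local Notation m := (n %/ r)%N.

Lemma blk_subproof (i : 'I_m) (a : 'I_r) : (i * r + a < n)%N.
Proof.
apply: leq_trans (leq_divM n r).
by apply: leq_trans (leq_mul (ltn_ord i) (leqnn r)); rewrite mulSn addnC ltn_add2r.
Qed.

Definition blk (i : 'I_m) (a : 'I_r) : 'I_n := Ordinal (blk_subproof i a).

Definition block (K : Type) (M : 'M[K]_n) (i j : 'I_m) : 'M[K]_r :=
  mxsub (blk i) (blk j) M.

(* The first disjunct collects the last n - m r rows and columns. *)
Definition induced_measurements (e1 e2 : rel 'I_m) : {set 'I_n * 'I_n} :=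
  [set pq : 'I_n * 'I_n |
    [|| (m * r <= pq.1)%N, (m * r <= pq.2)%N |
     [exists i, exists j, exists a, exists b,
       [&& pq.1 == blk i a, pq.2 == blk j b &
           e1 i j || (e2 i j && (a != b))]]]].

End Blocks.

Section Completion.
Variables (R : realType) (n r : nat).
Implicit Types (M : 'M[R]_n) (Omega : {set 'I_n * 'I_n}) (X Y : 'M[R]_(n, r)).

Definition psd M : Prop :=
  M^T = M /\ forall v : 'cV[R]_n, 0 <= (v^T *m M *m v) ord0 ord0.

Definition mask Omega M : 'M[R]_n :=
  \matrix_(p, q) (if (p, q) \in Omega then M p q else 0).

Definition frobenius M : R := Num.sqrt (\sum_p \sum_q M p q ^+ 2).

(* A completion problem is given by its data (M, Omega), n and r being fixed. *)
Definition class_L (e1 e2 : rel 'I_(n %/ r)) M Omega : Prop :=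
  [/\ psd M /\ \rank M = r,
      forall i j : 'I_(n %/ r), \rank (block M i j : 'M[R]_r) = r
    & [/\ Omega = induced_measurements e1 e2,
          connected_graph e1 & ~ bipartite e1]].

Definition objective M Omega X : R :=
  frobenius (mask Omega (X *m X^T - M)) ^+ 2.

Definition local_min (f : 'M[R]_(n, r) -> R) X : Prop :=
  \forall Y \near X, f X <= f Y.

Definition spurious (f : 'M[R]_(n, r) -> R) X : Prop :=
  local_min f X /\ inf (range f) < f X.

Definition orthogonal_mx (Q : 'M[R]_r) : Prop := Q *m Q^T = 1%:M.

Definition equivalent X Y : Prop :=
  exists2 Q : 'M[R]_r, orthogonal_mx Q & Y = X *m Q.

Definition spurious_classes (f : 'M[R]_(n, r) -> R) : set (set 'M[R]_(n, r)) :=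
  [set equivalent X | X in spurious f].

End Completion.

(* Main.v *)
Require Import Defs.
From mathcomp Require Import all_boot all_order all_algebra.
From mathcomp Require Import all_classical all_reals all_analysis.
From mathcomp Require Import lra.

(* Put X_eps with diagonal blocks I on S, eps I off S and zero tail rows, and
   M_eps = X_eps X_eps^T.  The zeros of the objective at eps = 0 satisfy
   X_i X_s^T = diag(+-1) for i in S (s a fixed vertex of S), all sign patterns
   occur, and every zero has entries bounded by 1: a self-loop makes X_i
   orthogonal for i in S, an edge of G_2[S] makes X_i X_j^T diagonal, and
   maximality of S kills the blocks off S.  Hence the objective at eps = 0 is
   bounded below by a positive constant on the boundary of each sign chamber of
   the box [-2, 2]^(n x r), and for eps > 0 small its minimum over the chamber is
   interior, that is, a local minimum.  For eps > 0, connectedness of G_1 and the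
   self-loop at s make X_i X_s^T a positive multiple of I at every zero, so all
   chambers but the positive one give spurious solutions; the signs are invariant
   under X |-> X Q, so distinct chambers give distinct classes. *)

Set Implicit Arguments.
Unset Strict Implicit.
Unset Printing Implicit Defensive.

Import Order.TTheory GRing.Theory Num.Theory.
Import numFieldNormedType.Exports.

Local Open Scope classical_set_scope.
Local Open Scope card_scope.
Local Open Scope ring_scope.

(** * Compact boxes of matrices, and local minima obtained from constrained ones *)

Section Analysis.
Context {R : realType}.

Lemma vec_mx_continuous m n : continuous (@vec_mx R m n).
Proof.
move=> u A [P nP sPA].
have nPv i j : \forall v \near u, P i j ((v : 'rV[R]_(m * n)) 0 (mxvec_index i j)).
  by have := nP i j; rewrite mxE; exact: coord_continuous.
have : \forall v \near u, forall i j, P i j ((v : 'rV[R]_(m * n)) 0 (mxvec_index i j)).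
  apply: (@filter_forall _ _ (fun i (v : 'rV[R]_(m * n)) =>
            forall j, P i j (v 0 (mxvec_index i j))) (nbhs u)) => i.
  by apply: (@filter_forall _ _ (fun j (v : 'rV[R]_(m * n)) =>
            P i j (v 0 (mxvec_index i j))) (nbhs u)) => j; exact: nPv.
by apply: filterS => v Pv; apply: sPA => i j; rewrite mxE.
Qed.

(** The box is the image under the continuous map [vec_mx] of a product of segments, which is
    compact. *)
Lemma box_compact m n (b : R) :
  compact [set X : 'M[R]_(m, n) | forall i j, `|X i j| <= b].
Proof.
set B := (X in compact X).
have -> : B = vec_mx @` [set v : 'rV[R]_(m * n) |
    forall k, [set` `[(- b), b]] (v ord0 k)].
  apply/seteqP; split=> [X BX | _ [v Bv <-] i j] /=.
    exists (mxvec X); last exact: mxvecK.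
    by move=> k; case/mxvec_indexP: k => i j /=; rewrite mxvecE in_itv /= -ler_norml.
  by have := Bv (mxvec_index i j); rewrite mxE /= in_itv /= -ler_norml.
apply: continuous_compact.
  exact/continuous_subspaceT/vec_mx_continuous.
by apply: (@rV_compact _ _ (fun=> `[(- b), b]%classic)) => _; exact: segment_compact.
Qed.

Lemma closed_forall_ge0 (T : topologicalType) (I : Type) (P : I -> Prop)
    (h : I -> T -> R) : (forall i, continuous (h i)) ->
  closed [set x | forall i, P i -> 0 <= h i x].
Proof.
move=> hc.
have -> : [set x | forall i, P i -> 0 <= h i x] = \bigcap_(i in P) (h i @^-1` [set y | 0 <= y]).
  by apply/seteqP; split=> x.
apply: closed_bigI => i _; apply: preimage_closed; first by move=> x _; exact: hc.
exact: closed_ge.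
Qed.

Lemma near_forall_gt0 (T : topologicalType) (I : finType) (P : pred I)
    (h : I -> T -> R) x : (forall i, continuous (h i)) ->
  (forall i, P i -> 0 < h i x) -> \forall y \near x, forall i, P i -> 0 < h i y.
Proof.
move=> hc h0; apply: (@filter_forall _ _ (fun i y => P i -> 0 < h i y) (nbhs x)) => i.
case: (boolP (P i)) => [/h0 hi|_]; last exact: (@nearW _ (nbhs x)).
by have := hc i x _ (lt_nbhsr hi); apply: (@filterS _ (nbhs x)) => y hy _.
Unshelve. all: by end_near. Qed.

(** A minimizer of [f] over the closed chamber does no worse than [x0], so by the boundary
    hypothesis it is interior to [C] and off every wall. Nearby points then stay in the chamber, and
    the minimum is local without constraints. *)
Lemma chamber_local_min (T : topologicalType) (C : set T) (I : finType)
    (P : pred I) (h : I -> T -> R) (f : T -> R) (x0 : T) :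
  compact C -> (forall i, continuous (h i)) -> continuous f ->
  C x0 -> (forall i, P i -> 0 < h i x0) ->
  (forall x, C x -> ~ nbhs x C \/ (exists2 i, P i & h i x = 0) -> f x0 < f x) ->
  exists x, (forall i, P i -> 0 < h i x) /\ \forall y \near x, f x <= f y.
Proof.
move=> cC hc fc Cx0 hx0 bnd.
set K := C `&` [set x | forall i, P i -> 0 <= h i x].
have cK : compact K by apply: compact_closedI => //; exact: closed_forall_ge0.
have Kx0 : K x0 by split=> // i /hx0/ltW.
have [|x] := @compact_EVT_min T R f K (ex_intro _ x0 Kx0) cK; first exact: continuous_subspaceT.
rewrite inE => -[Cx hx] xmin.
have fx : f x <= f x0 by apply: xmin; rewrite inE.
have Cx' : nbhs x C.
  by apply: contrapT => nC; move: (bnd x Cx (or_introl nC)); rewrite ltNge fx.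
have {}hx i : P i -> 0 < h i x.
  move=> Pi; rewrite lt_neqAle hx // andbT; apply/eqP => h0.
  have := bnd x Cx (or_intror _); rewrite ltNge fx => /(_ _)/negP; case=> //.
  by exists i.
exists x; split => //.
near=> y; apply: xmin; rewrite inE; split; first by near: y.
move=> i Pi; apply/ltW; move: i Pi; near: y; exact: near_forall_gt0.
Unshelve. all: by end_near. Qed.

End Analysis.

(** * Propagation along paths, and maximal independent sets *)

Section Graph.
Variables (T : finType) (e : rel T).

Lemma connect_invariant (Q : pred T) x y :
  (forall u v, e u v -> Q u -> Q v) -> connect e x y -> Q x -> Q y.
Proof.
move=> stepQ /connectP[p]; elim: p x => [x _ -> //|z p IHp x] /= /andP[xz pz] eqy Qx.
by apply: IHp pz eqy _; exact: stepQ xz Qx.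
Qed.

(** Otherwise [y |: S] would still be independent, against maximality. *)
Lemma maximal_independent_neighbor (S : {set T}) y : symmetric e ->
  maximal_independent e S -> y \notin S -> exists2 x, x \in S & e x y.
Proof.
move=> e_sym /maxsetP[/forall_inP Sind Smax] yS.
apply/exists_inP; apply: contraNT yS => /exists_inPn noadj.
suff <- : y |: S = S by rewrite setU11.
apply: Smax; last exact: finset.subsetUr.
apply/forall_inP => u /setU1P uS; apply/forall_inP => v /setU1P vS; apply/implyP => uv.
case: uS vS uv => [->|uS] [->|vS]; rewrite ?eqxx // => uv.
- by rewrite e_sym; exact: noadj.
- exact: noadj.
- exact: implyP (forall_inP (Sind u uS) v vS) uv.
Qed.

End Graph.

(** * Indexing of rows by block and position *)

Section Blocks.
Variables (n r : nat).
Local Notation m := (n %/ r)%N.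
Implicit Types (i j : 'I_m) (a b : 'I_r).

Lemma eq_blk i j a b : (blk i a == blk j b) = (i == j) && (a == b).
Proof.
apply/eqP/andP => [/(congr1 val) /= eq_ia|[/eqP -> /eqP ->] //].
have r_gt0 : (0 < r)%N := leq_ltn_trans (leq0n a) (ltn_ord a).
have /(congr1 (fun k => k %/ r)%N) := eq_ia.
rewrite !divnMDl // (divn_small (ltn_ord a)) (divn_small (ltn_ord b)) !addn0 => /val_inj eq_ij.
by move: eq_ia; rewrite eq_ij => /addnI/val_inj ->.
Qed.

Lemma blk_lt i a : (blk i a < m * r)%N.
Proof.
by apply: leq_trans (leq_mul (ltn_ord i) (leqnn r)); rewrite /= mulSn addnC ltn_add2r.
Qed.

Lemma blkP (p : 'I_n) : (p < m * r)%N -> exists i a, p = blk i a.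
Proof.
move=> lt_p; have r_gt0 : (0 < r)%N by case: (r) lt_p; rewrite ?muln0.
have lt_i : (p %/ r < m)%N by rewrite ltn_divLR.
exists (Ordinal lt_i), (Ordinal (ltn_pmod p r_gt0)).
by apply: val_inj; rewrite /= -divn_eq.
Qed.

Lemma mem_induced_tail (e1 e2 : rel 'I_m) (p q : 'I_n) :
  (m * r <= p)%N -> (p, q) \in induced_measurements e1 e2.
Proof. by rewrite inE /= => ->. Qed.

Lemma mem_induced_blk (e1 e2 : rel 'I_m) i j a b :
  ((blk i a, blk j b) \in induced_measurements e1 e2) =
  e1 i j || (e2 i j && (a != b)).
Proof.
have not_tail (k : 'I_m) (c : 'I_r) : (m * r <= blk k c)%N = false by rewrite leqNgt blk_lt.
rewrite inE (not_tail i a) (not_tail j b) [fst _]/= [snd _]/=; apply/idP/idP.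
  case/existsP=> i' /existsP[j' /existsP[a' /existsP[b']]].
  by rewrite !eq_blk => /and3P[/andP[/eqP<- /eqP<-] /andP[/eqP<- /eqP<-]].
move=> ij; apply/existsP; exists i; apply/existsP; exists j.
by apply/existsP; exists a; apply/existsP; exists b; rewrite !eqxx.
Qed.

End Blocks.

(** * Factors with diagonal blocks and their Gram matrices *)

Section Stack.
Variables (R : realType) (n r : nat).
Local Notation m := (n %/ r)%N.
Implicit Types (d : 'I_m -> 'I_r -> R) (i j : 'I_m) (a b : 'I_r).

(* The blocks [d i] of the stacked matrix are diagonal; its last n - m r rows vanish. *)
Definition stack d : 'M[R]_(n, r) :=
  \matrix_(p, b) \sum_(i | p == blk i b) d i b.

Lemma stack_blk d i a b : stack d (blk i a) b = if a == b then d i b else 0.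
Proof.
rewrite mxE; under eq_bigl do rewrite eq_blk.
case: eqP => _; last by rewrite big_pred0 // => j; rewrite andbF.
by under eq_bigl do rewrite andbT eq_sym; rewrite big_pred1_eq.
Qed.

Lemma stack_tail d (p : 'I_n) b : (m * r <= p)%N -> stack d p b = 0.
Proof.
move=> le_p; rewrite mxE big_pred0 // => i; apply/negbTE/eqP => eq_p.
by have := blk_lt i b; rewrite -eq_p ltnNge le_p.
Qed.

Lemma gramE (X Y : 'M[R]_(n, r)) p q : (X *m Y^T) p q = \sum_k X p k * Y q k.
Proof. by rewrite mxE; apply: eq_bigr => k _; rewrite mxE. Qed.

Lemma stack_gram_blk d i j a b :
  (stack d *m (stack d)^T) (blk i a) (blk j b) = if a == b then d i a * d j a else 0.
Proof.
rewrite gramE (bigD1 a) //= big1 => [|k neq_ka].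
  by rewrite !stack_blk eqxx addr0 eq_sym; case: eqP => _; rewrite ?mulr0.
by rewrite stack_blk eq_sym (negbTE neq_ka) mul0r.
Qed.

Lemma stack_gram_tail d (p q : 'I_n) : (m * r <= p)%N || (m * r <= q)%N ->
  (stack d *m (stack d)^T) p q = 0.
Proof.
move=> le_pq; rewrite gramE big1 // => k _; case/orP: le_pq => le_p.
  by rewrite stack_tail // mul0r.
by rewrite [X in _ * X]stack_tail // mulr0.
Qed.

Lemma gram_blk (X : 'M[R]_(n, r)) i j a b :
  (X *m X^T) (blk i a) (blk j b) =
  (rowsub (blk i) X *m (rowsub (blk j) X)^T) a b.
Proof. by rewrite !mxE; apply: eq_bigr => k _; rewrite !mxE. Qed.

End Stack.

Lemma gram_continuous (R : realType) n r p q :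
  continuous (fun X : 'M[R]_(n, r) => (X *m X^T) p q).
Proof.
have -> : (fun X : 'M[R]_(n, r) => (X *m X^T) p q) = (fun X => \sum_k X p k * X q k).
  by apply/funext => X; exact: gramE.
apply: (continuous_big (@add_continuous R)) => k _ X.
exact: (continuousM (@coord_continuous R n r p k X) (@coord_continuous R n r q k X)).
Qed.

(** * The objective as a sum of squared residuals *)

Section Objective.
Variables (R : realType) (n r : nat) (Omega : {set 'I_n * 'I_n}).
Implicit Types (M : 'M[R]_n) (X Y : 'M[R]_(n, r)).

Lemma objectiveE M X :
  objective M Omega X = \sum_(u in Omega) ((X *m X^T) u.1 u.2 - M u.1 u.2) ^+ 2.
Proof.
rewrite /objective /frobenius sqr_sqrtr; last first.
  by apply: sumr_ge0 => p _; apply: sumr_ge0 => q _; exact: sqr_ge0.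
rewrite pair_big [RHS]big_mkcond /=; apply: eq_bigr => -[p q] _ /=.
by rewrite mxE; case: ifP => _; [rewrite !mxE|rewrite expr0n].
Qed.

Lemma objective_ge0 M X : 0 <= objective M Omega X.
Proof. exact: sqr_ge0. Qed.

Lemma objective_eq0 M X : objective M Omega X = 0 <->
  forall p q, (p, q) \in Omega -> (X *m X^T) p q = M p q.
Proof.
rewrite objectiveE; split=> [/eqP|eqM]; last first.
  by rewrite big1 // => -[p q] /eqM /= ->; rewrite subrr expr0n.
rewrite psumr_eq0 => [/allP eq0 p q pq|u _]; last exact: sqr_ge0.
have := eq0 (p, q) (mem_index_enum _).
by rewrite pq sqrf_eq0 subr_eq0 => /eqP.
Qed.

(** Entrywise this is [(a + b)^2 <= 2 a^2 + 2 b^2], with [a] the residual for [M] and [b] the change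
    of target. It serves in both directions between eps = 0 and eps > 0. *)
Lemma objective_perturb M M' X (d : R) :
  (forall p q, `|M p q - M' p q| <= d) ->
  objective M' Omega X <= 2 * objective M Omega X + 2 * (#|Omega|%:R * d ^+ 2).
Proof.
move=> Md; rewrite !objectiveE -mulrDr (mulr_natl _ #|Omega|) -sumr_const -big_split /= mulr_sumr.
apply: ler_sum => -[p q] _ /=; move: (Md p q).
move: ((X *m X^T) p q) (M p q) (M' p q) => x y z yz.
have : (y - z) ^+ 2 <= d ^+ 2 by rewrite -[leLHS]real_normK ?num_real // lerXn2r // nnegrE (le_trans _ yz).
have := sqr_ge0 ((x - y) - (y - z)).
by rewrite !expr2; nra.
Qed.

Lemma objective_continuous M : continuous (objective M Omega : 'M[R]_(n, r) -> R).
Proof.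
have -> : (objective M Omega : 'M[R]_(n, r) -> R) =
    (fun X => \sum_(u in Omega) ((X *m X^T) u.1 u.2 - M u.1 u.2) *
                                ((X *m X^T) u.1 u.2 - M u.1 u.2)).
  by apply/funext => X; rewrite objectiveE; apply: eq_bigr => u _; rewrite expr2.
apply: (continuous_big (@add_continuous R)) => u _ X.
have gc := continuousB (@gram_continuous R n r u.1 u.2 X) (@cst_continuous _ _ (M u.1 u.2) X).
exact: (continuousM gc gc).
Qed.

Lemma equivalent_gram X Y : equivalent X Y -> Y *m Y^T = X *m X^T.
Proof.
by move=> [Q QQ ->]; rewrite trmx_mul mulmxA -(mulmxA X) QQ mulmx1.
Qed.

Lemma equivalent_refl X : equivalent X X.
Proof. by exists 1%:M; [rewrite /orthogonal_mx trmx1 mulmx1 | rewrite mulmx1]. Qed.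

End Objective.

Lemma mxrank_mxsub_le (F : fieldType) m n m' n' (f : 'I_m' -> 'I_m)
    (g : 'I_n' -> 'I_n) (A : 'M[F]_(m, n)) : (\rank (mxsub f g A) <= \rank A)%N.
Proof.
rewrite -[A in mxsub _ _ A]mulmx1 mxsub_mul -[A in rowsub f A]mul1mx mxsub_mul mxsub_id.
by apply: leq_trans (mxrankM_maxl _ _) _; exact: mxrankM_maxr.
Qed.

(** * Ground truths whose blocks are scalar matrices *)

Section Target.
Variables (R : realType) (n r : nat).
Local Notation m := (n %/ r)%N.
Implicit Types (c : 'I_m -> R) (i j : 'I_m) (a b : 'I_r).

Definition target c : 'M[R]_n :=
  stack (fun i (_ : 'I_r) => c i) *m (stack (fun i (_ : 'I_r) => c i))^T.

Lemma target_block c i j : block (target c) i j = (c i * c j)%:M :> 'M[R]_r.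
Proof.
apply/matrixP => a b.
by rewrite [LHS]mxE [RHS]mxE stack_gram_blk; case: eqP.
Qed.

Lemma target_psd c : psd (target c).
Proof.
rewrite /target; move: (stack _) => X; split; first by rewrite trmx_mul trmxK.
move=> v; rewrite mulmxA -mulmxA -[X in X *m _](trmxK) trmx_mul trmxK mxE.
by apply: sumr_ge0 => k _; rewrite mxE -expr2 sqr_ge0.
Qed.

Lemma target_block_rank c i j : c i != 0 -> c j != 0 ->
  \rank (block (target c) i j : 'M[R]_r) = r.
Proof.
move=> ci cj; apply: mxrank_unit.
by rewrite target_block unitmxE det_scalar unitrX // unitfE mulf_neq0.
Qed.

(** The factor has [r] columns, and the invertible block at [(i, i)] gives the reverse bound. *)
Lemma target_rank c i : c i != 0 -> \rank (target c) = r.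
Proof.
move=> ci; apply/eqP; rewrite eqn_leq mulmx_max_rank /=.
by rewrite -[leqLHS](target_block_rank ci ci) mxrank_mxsub_le.
Qed.

End Target.

(** * Structure of the zeros of the objective *)

Section Recovery.
Variables (R : realType) (n r : nat).
Local Notation m := (n %/ r)%N.
Variables (e1 e2 : rel 'I_m).
Local Notation Omega := (induced_measurements e1 e2).
Implicit Types (c : 'I_m -> R) (i j : 'I_m) (a b : 'I_r) (X : 'M[R]_(n, r)).

(* The diagonal entry u.2 of X_{u.1} X_s^T; its sign is constant on an equivalence class. *)
Definition overlap (s : 'I_m) (u : 'I_m * 'I_r) X : R :=
  (X *m X^T) (blk u.1 u.2) (blk s u.2).

Lemma zero_block1 c X i j : objective (target c) Omega X = 0 -> e1 i j ->
  rowsub (blk i) X *m (rowsub (blk j) X)^T = (c i * c j)%:M.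
Proof.
move=> /objective_eq0 X0 ij; apply/matrixP => a b; rewrite -gram_blk X0 //.
  by rewrite -target_block [RHS]mxE.
by rewrite mem_induced_blk ij.
Qed.

Lemma zero_block2 c X i j : objective (target c) Omega X = 0 -> e2 i j ->
  is_diag_mx (rowsub (blk i) X *m (rowsub (blk j) X)^T).
Proof.
move=> /objective_eq0 X0 ij; apply/is_diag_mxP => a b ab; rewrite -gram_blk X0 //.
  by rewrite stack_gram_blk ifN.
by rewrite mem_induced_blk ij; apply/orP; right.
Qed.

(** The loop at [s] makes the block [Q] orthogonal, and the identity [X_i = c i *: Q] spreads from
    [s] along the edges of [e1]; the overlap is then [c u.1]. *)
Lemma exact_overlap_gt0 c X s u : (forall i, 0 < c i) -> c s = 1 -> e1 s s ->
  connected_graph e1 -> objective (target c) Omega X = 0 -> 0 < overlap s u X.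
Proof.
move=> c_gt0 cs1 ss e1_conn X0.
set Q := rowsub (blk s) X.
have QQ : Q *m Q^T = 1%:M by rewrite (zero_block1 X0 ss) cs1 mulr1.
have Q'Q : Q^T *m Q = 1%:M := mulmx1C QQ.
have : rowsub (blk u.1) X == c u.1 *: Q.
  apply: (connect_invariant (Q := fun i => rowsub (blk i) X == c i *: Q)
            _ (e1_conn s u.1)); last by rewrite cs1 scale1r.
  (* The edge gives [c i *: (Q *m X_j^T) = (c i * c j)%:M]; cancelling [c i] and multiplying by
     [Q^T] isolates [X_j^T]. *)
  move=> i j ij /eqP Xi; apply/eqP/trmx_inj.
  have := zero_block1 X0 ij; rewrite Xi -scalemxAl -scale_scalar_mx.
  move=> /(scalerI (lt0r_neq0 (c_gt0 i))) /(congr1 (mulmx Q^T)).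
  by rewrite mulmxA Q'Q mul1mx mul_mx_scalar linearZ.
rewrite /overlap => /eqP Xu; rewrite gram_blk Xu -scalemxAl QQ !mxE eqxx mulr1.
exact: c_gt0.
Qed.

(** * Zeros in the limit case eps = 0 *)

Section ZeroOffset.
Variables (S : {set 'I_m}) (s : 'I_m) (X : 'M[R]_(n, r)).
Hypotheses (e1_sym : symmetric e1) (e2_sym : symmetric e2).
Hypotheses (S_max : maximal_independent e1 S) (S_loops : forall i, i \in S -> e1 i i).
Hypotheses (e2S_conn : connected_induced e2 S) (sS : s \in S).
Hypothesis X0 : objective (target (fun i => (i \in S)%:R)) Omega X = 0.
Local Notation B i := (rowsub (blk i) X).

Let B_orth i : i \in S -> B i *m (B i)^T = 1%:M.
Proof. by move=> iS; rewrite (zero_block1 X0 (S_loops iS)) iS mulr1. Qed.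

(** Connectedness of [e2] on [S] makes [X_i X_s^T] diagonal. This matrix is also orthogonal, so a
    zero on its diagonal would leave a zero row. *)
Lemma limit_overlap_neq0 u : u.1 \in S -> overlap s u X != 0.
Proof.
case: u => i a /= iS; rewrite /overlap gram_blk.
have B'B j : j \in S -> (B j)^T *m B j = 1%:M by move=> /B_orth/mulmx1C.
have : is_diag_mx (B i *m (B s)^T).
  apply: (connect_invariant (Q := fun i => is_diag_mx (B i *m (B s)^T))
            _ (e2S_conn sS iS)) => [j k /and3P[jS kS jk] /is_diag_mxP js|]; last first.
    by rewrite B_orth // scalar_mx_is_diag.
  have /is_diag_mxP kj := zero_block2 X0 (etrans (e2_sym k j) jk).
  (* Inserting [X_j^T X_j = 1] writes [X_k X_s^T] as the product of the diagonal matrices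
     [X_k X_j^T] and [X_j X_s^T]. *)
  apply/is_diag_mxP => b d bd; rewrite -[B k]mulmx1 -(B'B j jS) mulmxA -mulmxA mxE.
  by apply: big1 => l _; case: (eqVneq b l) => [<-|bl]; rewrite ?(js _ _ bd) ?(kj _ _ bl) ?mulr0 ?mul0r.
set D := B i *m (B s)^T => /is_diag_mxP diagD.
apply/eqP => Da0.
have : D *m D^T = 1%:M.
  by rewrite trmx_mul trmxK mulmxA -(mulmxA (B i)) B'B // mulmx1 B_orth.
move=> /matrixP/(_ a a); rewrite !mxE eqxx big1 => [/esym/eqP|b _]; first by rewrite oner_eq0.
by case: (eqVneq a b) => [<-|ab]; rewrite ?Da0 ?(diagD _ _ ab) mul0r.
Qed.

(** Rows of blocks in [S] are unit vectors. Every other row is orthogonal to the orthonormal basis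
    formed by the rows of some block in [S], hence vanishes. *)
Lemma limit_entry_le1 p b : `|X p b| <= 1.
Proof.
have col0 i : i \in S -> (forall a, (X *m X^T) p (blk i a) = 0) -> X p b = 0.
  move=> iS Xp0.
  have : row p X *m (B i)^T = 0.
    apply/rowP => a; rewrite mxE [RHS]mxE -[RHS](Xp0 a) gramE.
    by apply: eq_bigr => k _; rewrite !mxE.
  move/(congr1 (mulmx^~ (B i))); rewrite -mulmxA (mulmx1C (B_orth iS)) mulmx1 mul0mx.
  by move/rowP/(_ b); rewrite !mxE.
have [/blkP[j [a eq_p]]|tail_p] := ltnP p (m * r)%N; last first.
  rewrite (col0 s) ?normr0 // => a.
  have /objective_eq0 -> := X0; first by rewrite stack_gram_tail ?tail_p.
  exact: mem_induced_tail.
have [jS|jS] := boolP (j \in S).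
  have /matrixP/(_ a a) := B_orth jS; rewrite -gram_blk -eq_p gramE !mxE eqxx mulr1n => sum1.
  rewrite -(expr_le1 (n := 2)) // real_normK ?num_real // -[leRHS]sum1 (bigD1 b) //= expr2 lerDl.
  by apply: sumr_ge0 => k _; rewrite -expr2 sqr_ge0.
have [i iS ij] := maximal_independent_neighbor e1_sym S_max jS.
rewrite (col0 i) ?normr0 // => d; rewrite eq_p gram_blk (zero_block1 X0 (etrans (e1_sym j i) ij)).
by rewrite (negbTE jS) mul0r !mxE mul0rn.
Qed.

End ZeroOffset.

End Recovery.

(** * Sign chambers and the passage from eps = 0 to small eps > 0 *)

Section Instance.
Variables (R : realType) (n r : nat).
Local Notation m := (n %/ r)%N.
Variables (e1 e2 : rel 'I_m) (S : {set 'I_m}) (s : 'I_m).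
Hypotheses (e1_sym : symmetric e1) (e2_sym : symmetric e2).
Hypotheses (S_max : maximal_independent e1 S) (S_loops : forall i, i \in S -> e1 i i).
Hypotheses (e1_conn : connected_graph e1) (e2S_conn : connected_induced e2 S).
Hypothesis sS : s \in S.
Local Notation Omega := (induced_measurements e1 e2).
Local Notation limit_objective :=
  (objective (target (fun i => (i \in S)%:R)) Omega : 'M[R]_(n, r) -> R).
Implicit Types (X : 'M[R]_(n, r)) (A : {set 'I_m * 'I_r}).

Definition offset (eps : R) (i : 'I_m) : R := if i \in S then 1 else eps.

(** A sign pattern is encoded by the set [A] of its negative positions, so that counting patterns is
    counting subsets. *)
Definition sgn A u : R := if u \in A then -1 else 1.

Definition signed_factor A : 'M[R]_(n, r) :=
  stack (fun i a => if i \in S then sgn A (i, a) else 0).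

Lemma sgn_sqr A u : sgn A u * sgn A u = 1.
Proof. by rewrite /sgn; case: ifP; rewrite ?mulrNN mulr1. Qed.

(** Signs enter only diagonal entries of blocks [(i, j)] with [i] and [j] in [S]. Such an entry is
    observed only along an edge of [e1], where independence forces [i = j] and the sign is
    squared. *)
Lemma limit_objective_signed A : limit_objective (signed_factor A) = 0.
Proof.
apply/objective_eq0 => p q pq.
have [/blkP[i [a def_p]]|tail_p] := ltnP p (m * r)%N; last first.
  by rewrite !stack_gram_tail ?tail_p.
have [/blkP[j [b def_q]]|tail_q] := ltnP q (m * r)%N; last first.
  by rewrite !stack_gram_tail ?tail_q ?orbT.
move: pq; rewrite {p}def_p {q}def_q mem_induced_blk !stack_gram_blk.
case: eqP => // _; rewrite andbF orbF => ij.
have [iS|_] := boolP (i \in S); last by rewrite !mul0r.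
have [jS|_] := boolP (j \in S); last by rewrite !mulr0.
have /maxsetP[/forall_inP/(_ i iS)/forall_inP/(_ j jS)] := S_max.
by rewrite ij implybF negbK => /eqP <- _; rewrite sgn_sqr mulr1.
Qed.

(** Positive signs at [s] normalize away column sign flips, which are right multiplications by
    orthogonal matrices. *)
Lemma overlap_signed A u : u.1 \in S -> (forall a, (s, a) \notin A) ->
  overlap s u (signed_factor A) = sgn A u.
Proof.
case: u => i a /= iS sA; rewrite /overlap stack_gram_blk eqxx iS sS.
by rewrite [X in _ * X]/sgn (negbTE (sA a)) mulr1.
Qed.

Lemma signed_entry_le1 A p b : `|signed_factor A p b| <= 1.
Proof.
exact: (limit_entry_le1 e1_sym S_max S_loops sS (limit_objective_signed A)).
Qed.

(** The possible deviations are 0, [eps] and [eps ^+ 2]; the last is where [eps <= 1] enters. *)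
Lemma offset_near eps p q : 0 <= eps <= 1 ->
  `|target (r := r) (offset eps) p q - target (r := r) (fun i => (i \in S)%:R) p q| <= eps.
Proof.
move=> /andP[eps0 eps1].
have [/blkP[i [a ->]]|tail_p] := ltnP p (m * r)%N; last first.
  by rewrite !stack_gram_tail ?tail_p // subrr normr0.
have [/blkP[j [b ->]]|tail_q] := ltnP q (m * r)%N; last first.
  by rewrite !stack_gram_tail ?tail_q ?orbT // subrr normr0.
rewrite !stack_gram_blk /offset; case: eqP => _; last by rewrite subrr normr0.
case: (i \in S); case: (j \in S); rewrite ?mulr1 ?mul1r ?mulr0 ?mul0r ?subrr ?subr0 ?normr0 //.
- by rewrite ger0_norm.
- by rewrite ger0_norm.
- by rewrite ger0_norm ?mulr_ge0 // ler_piMr.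
Qed.

(* Vanishes, inside the box [-2, 2]^(n x r), exactly on the walls of the sign chambers. *)
Definition margin X : R :=
  (\prod_(v : 'I_n * 'I_r) (4 - X v.1 v.2 ^+ 2)) * \prod_(u | u.1 \in S) overlap s u X.

Let box : set 'M[R]_(n, r) := [set X | forall p b, `|X p b| <= 2].

Lemma entry_margin_continuous (v : 'I_n * 'I_r) :
  continuous (fun X : 'M[R]_(n, r) => 4 - X v.1 v.2 ^+ 2).
Proof.
have -> : (fun X : 'M[R]_(n, r) => 4 - X v.1 v.2 ^+ 2) =
    (fun X => 4 - X v.1 v.2 * X v.1 v.2) by apply/funext => X; rewrite expr2.
move=> X; have vc := @coord_continuous R n r v.1 v.2 X.
exact: (continuousB (@cst_continuous _ _ (4 : R) X) (continuousM vc vc)).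
Qed.

Lemma margin_continuous : continuous margin.
Proof.
have mulc := @mul_continuous R.
move=> X; apply: (@continuousM _ _ (fun X => \prod_(v : 'I_n * 'I_r) (4 - X v.1 v.2 ^+ 2))
  (fun X => \prod_(u | u.1 \in S) overlap s u X)).
  by apply: (continuous_big mulc) => v _; exact: entry_margin_continuous.
by apply: (continuous_big mulc) => u _; exact: gram_continuous.
Qed.

Lemma entry_marginE X v : (0 < 4 - X v.1 v.2 ^+ 2) = (`|X v.1 v.2| < 2).
Proof.
have four : 4 = 2 ^+ 2 :> R by rewrite -natrX.
by rewrite subr_gt0 -real_normK ?num_real // four ltr_pXn2r // nnegrE.
Qed.

Lemma margin_eq0 X : box X ->
  ~ nbhs X box \/ (exists2 u, u.1 \in S & overlap s u X = 0) -> margin X = 0.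
Proof.
move=> bX [nbX|[u uS u0]]; last by rewrite /margin (bigD1 u) //= u0 mul0r mulr0.
apply: contrapT => /eqP; rewrite mulf_eq0 negb_or => /andP[/prodf_neq0 mX _].
apply: nbX.
have : forall v : 'I_n * 'I_r, true -> 0 < 4 - X v.1 v.2 ^+ 2.
  move=> v _; have four : 4 = 2 ^+ 2 :> R by rewrite -natrX.
  rewrite lt_neqAle eq_sym mX // subr_ge0 -real_normK ?num_real //.
  by rewrite four lerXn2r ?nnegrE.
move/(near_forall_gt0 entry_margin_continuous); apply: filterS => Y hY p b.
by apply: ltW; rewrite -(entry_marginE Y (p, b)) hY.
Qed.

(** The walls form a compact set, so the minimum is attained there. It is not 0, since at a zero the
    entries are at most 1 in absolute value and no overlap over [S] vanishes, which makes the margin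
    nonzero. *)
Lemma limit_objective_margin :
  exists2 d : R, 0 < d & forall X, box X -> margin X = 0 -> d <= limit_objective X.
Proof.
pose K := box `&` margin @^-1` [set y | y = 0].
have cK : compact K.
  apply: compact_closedI; first exact: box_compact.
  by apply: preimage_closed => [X _|]; [exact: margin_continuous|exact: closed_eq].
have [[X KX]|noK] := pselect (K !=set0); last first.
  (* With no wall point at all, any positive constant will do. *)
  by exists 1 => // X bX gX; case: noK; exists X.
have [|Y] := @compact_EVT_min _ R limit_objective K (ex_intro _ X KX) cK.
  exact/continuous_subspaceT/objective_continuous.
rewrite inE => -[bY gY] minY; exists (limit_objective Y); last first.
  by move=> Z bZ gZ; apply: minY; rewrite inE.
rewrite lt_neqAle objective_ge0 andbT; apply/eqP => /esym Y0.
move: gY; rewrite /= /margin => /eqP; rewrite mulf_eq0 => /orP[] /prodf_eq0[].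
  move=> v _; apply/negP/lt0r_neq0; rewrite entry_marginE.
  by apply: le_lt_trans (limit_entry_le1 e1_sym S_max S_loops sS Y0 _ _) _; rewrite ltr1n.
by move=> u uS; apply/negP; exact: (limit_overlap_neq0 e2_sym S_loops e2S_conn sS Y0).
Qed.

Lemma offset_local_min : exists2 eps : R, 0 < eps &
  forall A, (forall a, (s, a) \notin A) -> exists X,
    local_min (objective (target (offset eps)) Omega) X /\
    forall u, u.1 \in S -> 0 < sgn A u * overlap s u X.
Proof.
have [d d0 dmin] := limit_objective_margin.
pose k : R := #|Omega|%:R; have k0 : 0 <= k by exact: ler0n.
have D0 : 0 < d + 6 * k + 1 by rewrite -addrA ltr_wpDr // addr_ge0 ?mulr_ge0.
(* On the walls the perturbed objective is at least [d / 2 - k * eps ^+ 2], and at the signed factor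
   it is at most [2 * k * eps ^+ 2]. So [6 * k * eps ^+ 2 < d] is what is needed; it follows from
   [eps <= 1] and [6 * k * eps < d]. *)
pose eps := d / (d + 6 * k + 1).
have eps0 : 0 < eps by rewrite divr_gt0.
have eps1 : eps <= 1 by rewrite ler_pdivrMr // mul1r -addrA lerDl addr_ge0 ?mulr_ge0.
have epsK : 6 * (k * eps ^+ 2) < d.
  have : eps * (d + 6 * k + 1) = d by rewrite divfK // lt0r_neq0.
  have : k * eps ^+ 2 <= k * eps by rewrite ler_wpM2l // expr2 ler_piMr // ltW.
  have := mulr_gt0 eps0 d0; nra.
have eps01 : 0 <= eps <= 1 by rewrite ltW.
have near01 p q := offset_near p q eps01.
exists eps => // A sA.
have [||||||X [signX minX]] := @chamber_local_min R _ box _ [pred u : 'I_m * 'I_r | u.1 \in S]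
    (fun u X => sgn A u * overlap s u X) (objective (target (offset eps)) Omega) (signed_factor A).
- exact: box_compact.
- move=> u X; apply: (continuousM (@cst_continuous _ _ (sgn A u) X)); exact: gram_continuous.
- exact: objective_continuous.
- by move=> p b; apply: le_trans (signed_entry_le1 A p b) _; rewrite ler1n.
- by move=> u uS; rewrite overlap_signed // sgn_sqr.
- move=> X bX bd.
  have gX : margin X = 0.
    apply: margin_eq0 => //; case: bd => [|[u uS /eqP]]; first by left.
    rewrite mulf_eq0 => /orP[|/eqP u0]; last by right; exists u.
    by move/eqP => sg0; have := sgn_sqr A u; rewrite sg0 mul0r => /esym/eqP; rewrite oner_eq0.
  have := dmin X bX gX.
  have := objective_perturb Omega X near01.
  have near10 p q : `|target (r := r) (fun i => (i \in S)%:R) p q - target (r := r) (offset eps) p q| <= eps.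
    by rewrite distrC.
  have := objective_perturb Omega (signed_factor A) near10.
  rewrite limit_objective_signed -/k; lra.
by exists X.
Qed.

End Instance.

(** * Counting the spurious classes by sign patterns *)

Theorem theorem2 (R : realType) (n r : nat) (r_ge1 : (1 <= r)%N)
  (n_ge2r : (2 * r <= n)%N) (e1 e2 : rel 'I_(n %/ r))
  (G_pair : graph_pair e1 e2)
  (G1_connected : connected_graph e1) (G1_nonbipartite : ~ bipartite e1)
  (S : {set 'I_(n %/ r)}) (S_max : maximal_independent e1 S)
  (S_loops : forall i, i \in S -> e1 i i)
  (G2S_connected : connected_induced e2 S) :
  exists (M : 'M[R]_n) (Omega : {set 'I_n * 'I_n}),
    class_L e1 e2 M Omega /\
    `I_(2 ^ (r * (#|S| - 1)) - 1) #<= spurious_classes (objective (r:=r) M Omega).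
Proof.
have [e1_sym e2_sym _] := G_pair.
have [s sS] : exists s, s \in S.
  have lt_0m : (0 < n %/ r)%N by rewrite divn_gt0 // (leq_trans _ n_ge2r) // leq_pmull.
  have [oS|/(maximal_independent_neighbor e1_sym S_max)[s sS _]] :=
    boolP (Ordinal lt_0m \in S); first by exists (Ordinal lt_0m).
  by exists s.
have [eps eps0 lmin] := @offset_local_min R n r e1 e2 S s e1_sym e2_sym S_max S_loops G2S_connected sS.
have off0 i : 0 < offset S eps i by rewrite /offset; case: ifP.
pose M := target (r := r) (offset S eps); pose Omega := induced_measurements e1 e2.
exists M, Omega; split.
  split; [split; [exact: target_psd|] | |by split].
    by apply: (target_rank (i := s)); exact: lt0r_neq0.
  by move=> i j; apply: target_block_rank; exact: lt0r_neq0.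
(* The free sign positions: those at [s] are fixed to be positive, whence the exponent
   [r * (#|S| - 1)]. *)
pose W := finset.setX (S :\ s) [set: 'I_r].
have W_tail (A : {set 'I_(n %/ r) * 'I_r}) : A \subset W -> forall a, (s, a) \notin A.
  by move=> AW a; apply/negP => /(fintype.subsetP AW); rewrite !inE eqxx.
(* The empty pattern is the chamber of the exact factor; leaving it out accounts for the final
   [- 1]. *)
pose P := powerset W :\ finset.set0.
have /choice[X Xmin] : forall A : {set 'I_(n %/ r) * 'I_r}, exists X, A \in P ->
    local_min (objective M Omega) X /\ forall u, u.1 \in S -> 0 < sgn R A u * overlap s u X.
  move=> A; have [|_] := boolP (A \in P); last by exists 0.
  rewrite !inE => /andP[_ /W_tail/lmin[X HX]]; by exists X.
have cardP : #|P| = (2 ^ (r * (#|S| - 1)) - 1)%N.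
  have := cardsD1 finset.set0 (powerset W); rewrite powersetE finset.sub0set card_powerset.
  by rewrite finset.cardsX cardsT card_ord (cardsD1 s S) sS !add1n !subn1 mulnC => ->.
have mem_nth_P k : (k < #|P|)%N -> nth finset.set0 (enum P) k \in P.
  by move=> lt_k; rewrite -mem_enum mem_nth // -cardE.
rewrite -cardP.
suff /injfunPex[f] : exists2 f : nat -> set 'M[R]_(n, r),
    set_fun `I_#|P| (spurious_classes (objective M Omega)) f & set_inj `I_#|P| f.
  exact: inj_card_le f.
exists (fun k => equivalent (X (nth finset.set0 (enum P) k))).
  move=> k /= /mem_nth_P; move: (nth _ _ _) => A AP; exists (X A) => //.
  have [minX signX] := Xmin A AP; split => //.
  have [A_neq0 AW] : A != finset.set0 /\ A \subset W by move: AP; rewrite !inE => /andP[].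
  have [u uA] := finset.set0Pn _ A_neq0.
  have uS : u.1 \in S by have := fintype.subsetP AW u uA; rewrite !inE => /andP[/andP[_ ->]].
  (* A zero would have positive overlap at [u], where the pattern [A] prescribes a negative one. *)
  have fX : 0 < objective M Omega (X A).
    rewrite lt_neqAle objective_ge0 andbT eq_sym; apply/eqP => X0.
    have sc : offset S eps s = 1 by rewrite /offset sS.
    have := exact_overlap_gt0 u off0 sc (S_loops s sS) G1_connected X0.
    by have := signX u uS; rewrite /sgn uA mulN1r oppr_gt0 => /ltW; rewrite leNgt => /negP.
  (* The exact factor attains the value 0, which bounds the infimum from above. *)
  apply: le_lt_trans fX; apply: ge_inf; first by exists 0 => _ [Y _ <-]; exact: objective_ge0.
  by exists (stack (fun i _ => offset S eps i)) => //; apply/objective_eq0.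
move=> k l; rewrite !inE => /= lt_k lt_l eq_kl.
have kP := mem_nth_P _ lt_k; have lP := mem_nth_P _ lt_l.
apply/eqP; rewrite -(nth_uniq finset.set0 _ _ (enum_uniq P)) -?cardE //.
move: eq_kl kP lP; move: (nth _ _ k) (nth _ _ l) => A B eqAB AP BP; apply/eqP.
(* Equal classes give equal Gram matrices, hence equal overlaps, whose signs determine the
   pattern. *)
have /equivalent_gram gramAB : equivalent (X A) (X B).
  by rewrite eqAB; exact: equivalent_refl.
have [_ signA] := Xmin A AP; have [_ signB] := Xmin B BP.
apply/setP => u; have [uS|uS] := boolP (u.1 \in S).
  have := signA u uS; have := signB u uS; rewrite /overlap gramAB /sgn.
  by case: (u \in A); case: (u \in B) => //; lra.
have notW (C : {set 'I_(n %/ r) * 'I_r}) : C \in P -> u \notin C.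
  rewrite !inE => /andP[_ /fintype.subsetP CW]; apply/negP => /CW.
  by rewrite !inE (negbTE uS) andbF.
by rewrite (negbTE (notW A AP)) (negbTE (notW B BP)).
Qed.
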